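(* Let $a\le -1$ be an integer. Define $a_{\mathcal{G}}(n)$, $n\ge0$, by $a_{\mathcal{G}}(0)=1$, $a_{\mathcal{G}}(1)=-1$, $a_{\mathcal{G}}(2)=a$ and, for $n\ge3$, $$a_{\mathcal{G}}(n)=-\frac12\left(\sum_{k=0}^{n-2}a_{\mathcal{G}}(k)\binom{n-1}{k}2^{n-1-k}+\sum_{k=0}^{n-1}a_{\mathcal{G}}(k)\binom{n}{k}2^{n-k}\right).$$ For integers $0\le j\le d$ set $c_{\mathcal{G}}(j,d)=\sum_{k=j}^d2^{-k}\binom{d-j}{d-k}a_{\mathcal{G}}(k)$. Then for all $m\ge1$: $$0\le c_{\mathcal{G}}(0,4m)\le c_{\mathcal{G}}(1,4m)\le\cdots\le c_{\mathcal{G}}(2m,4m),$$ $$0\le c_{\mathcal{G}}(2m,4m+1)\le c_{\mathcal{G}}(2m-1,4m+1)\le\cdots\le c_{\mathcal{G}}(0,4m+1),$$ $$0\ge c_{\mathcal{G}}(0,4m+2)\ge c_{\mathcal{G}}(1,4m+2)\ge\cdots\ge c_{\mathcal{G}}(2m+1,4m+2),$$ $$0\ge c_{\mathcal{G}}(2m+1,4m+3)\ge c_{\mathcal{G}}(2m,4m+3)\ge\cdots\ge c_{\mathcal{G}}(0,4m+3).$$ *)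

(* Defs.v *)
From mathcomp Require Import all_boot all_order all_algebra.

Set Implicit Arguments.
Unset Strict Implicit.
Unset Printing Implicit Defensive.

Import Order.TTheory GRing.Theory Num.Theory.

Local Open Scope ring_scope.

Definition aG_next (a : int) (u : nat -> rat) (n : nat) : rat :=
  match n with
  | 0 => 1
  | 1 => -1
  | 2 => a%:~R
  | _ => - (1 / 2) *
         (\sum_(0 <= k < n.-1) u k * 'C(n.-1, k)%:R * 2 ^+ (n.-1 - k)
          + \sum_(0 <= k < n) u k * 'C(n, k)%:R * 2 ^+ (n - k))
  end.

(* Course-of-values recursion: the list of the first n terms of the sequence.
   The lemmas below give the equations that characterize aG. *)
Fixpoint aG_list (a : int) (n : nat) : seq rat :=
  if n is n'.+1 then
    let s := aG_list a n' in rcons s (aG_next a (nth 0 s) n')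
  else [::].

Definition aG (a : int) (n : nat) : rat := (aG_list a n.+1)`_n.

Definition cG (a : int) (j d : nat) : rat :=
  \sum_(j <= k < d.+1) 2 ^- k * 'C(d - j, d - k)%:R * aG a k.

Lemma size_aG_list a n : size (aG_list a n) = n.
Proof. by elim: n => //= n IHn; rewrite size_rcons IHn. Qed.

Lemma nth_aG_list a n k : (k < n)%N -> (aG_list a n)`_k = aG a k.
Proof.
elim: n => // n IHn; rewrite ltnS leq_eqVlt => /predU1P[-> //|lt_kn].
by rewrite /= nth_rcons size_aG_list lt_kn IHn.
Qed.

Lemma aGE a n : aG a n = aG_next a (nth 0 (aG_list a n)) n.
Proof. by rewrite /aG /= nth_rcons size_aG_list ltnn eqxx. Qed.

Lemma aG0 a : aG a 0 = 1.
Proof. by []. Qed.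

Lemma aG1 a : aG a 1 = -1.
Proof. by []. Qed.

Lemma aG2 a : aG a 2 = a%:~R.
Proof. by []. Qed.

Lemma aG_rec a n : (3 <= n)%N ->
  aG a n = - (1 / 2) *
    (\sum_(0 <= k < n.-1) aG a k * 'C(n.-1, k)%:R * 2 ^+ (n.-1 - k)
     + \sum_(0 <= k < n) aG a k * 'C(n, k)%:R * 2 ^+ (n - k)).
Proof.
case: n => [|[|[|n]]] // _; rewrite aGE [LHS]/aG_next.
by congr (_ * (_ + _)); apply: eq_big_nat => k /andP[_ ltk];
  rewrite nth_aG_list // ltnW.
Qed.

(* Main.v *)
Require Import Defs.
From mathcomp Require Import all_boot all_order all_algebra.
From mathcomp Require Import ring lra zify.

(** Put [b k = a_G(k) / 2^k]. Then [cG j d = ((1 + E)^(d-j) E^j b)(0)] for the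
    shift [E], so the [cG j d] form a Pascal-like triangle in which
    [cG j d.+1 - cG j.+1 d.+1 = cG j d]: monotonicity of a row is the sign of
    the previous one. In these terms the recurrence defining [a_G] reads
    [cG n n + cG 0 n + (cG 0 n.-1 - cG n.-1 n.-1) / 2 = 0], which forces
    [cG (d-j) d = (-1)^d cG j d]. By this symmetry, the middle entry of an odd
    row is half the middle entry of the previous row, and the first entry of an
    even row is [-1/2] times the first entry of the previous row. These values
    and the triangle rule propagate the signs from row to row. *)

Set Implicit Arguments.
Unset Strict Implicit.
Unset Printing Implicit Defensive.

Import Order.TTheory GRing.Theory Num.Theory.

Local Open Scope ring_scope.

Lemma cG_binomial a j p :
  cG a j (j + p) = \sum_(i < p.+1) 'C(p, i)%:R * (2 ^- (j + i) * aG a (j + i)).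
Proof.
rewrite /cG -addnS -{1}[j]add0n big_addn !addKn big_mkord.
apply: eq_bigr => i _; rewrite [(i + j)%N]addnC.
have -> : (j + p - (j + i) = p - i)%N by lia.
by rewrite bin_sub 1?mulrCA ?mulrA // -ltnS.
Qed.

Lemma cG_diag a n : cG a n n = 2 ^- n * aG a n.
Proof. by rewrite /cG big_nat1 !subnn bin0 mulr1. Qed.

Lemma cG_pascal a j d : (j <= d)%N ->
  cG a j d.+1 = cG a j d + cG a j.+1 d.+1.
Proof.
move=> /subnKC <-; move: (d - j)%N => p.
rewrite -addnS -[X in cG a j.+1 X]addSnnS !cG_binomial.
rewrite big_ord_recl [X in _ = X + _]big_ord_recl /= !bin0 -addrA; congr (_ + _).
under eq_bigr => i _ do rewrite /bump /= add1n binS natrD mulrDl.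
rewrite big_split /= big_ord_recr /= bin_small // mul0r addr0.
congr (_ + _); apply: eq_bigr => i _; last by rewrite addSnnS.
Qed.

Lemma cG_rec a n : (2 <= n)%N ->
  cG a n.+1 n.+1 + cG a 0 n.+1 + (cG a 0 n - cG a n n) / 2 = 0.
Proof.
move=> n_ge2.
(* Both sums of the recurrence have this shape, with [p = n] and [p = n.+1]: the binomial sum for
   [cG a 0 p] without its top term [cG a p p]. *)
have sumE p : \sum_(0 <= k < p) aG a k * 'C(p, k)%:R * 2 ^+ (p - k)
    = 2 ^+ p * (cG a 0 p - cG a p p).
  rewrite cG_diag -[X in cG a 0 X]add0n cG_binomial big_ord_recr /= binn mul1r.
  rewrite !add0n addrK big_mkord mulr_sumr; apply: eq_bigr => i _.
  by rewrite add0n expfB //; ring.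
have := aG_rec a (n := n.+1) n_ge2; rewrite /= !sumE.
have -> : aG a n.+1 = 2 ^+ n.+1 * cG a n.+1 n.+1.
  by rewrite cG_diag mulrA divff ?mul1r // expf_neq0.
have e_neq0 : 2 ^+ n != 0 :> rat by rewrite expf_neq0.
rewrite exprS => recE; apply: (mulfI e_neq0); rewrite mulr0.
by move: recE; move: (2 ^+ n) => e recE; lra.
Qed.

Section Triangle.

Variables (R : realFieldType) (c : nat -> nat -> R).
Hypothesis pascal : forall j d, (j <= d)%N -> c j d.+1 = c j d + c j.+1 d.+1.

(** By [pascal], raising [j] by one changes the left side by [c (d - j) d + s * c j d], which is
    zero by hypothesis. *)
Lemma triangle_defect_const d s :
    (forall j, (j <= d)%N -> c (d - j) d = - s * c j d) ->
  forall j, (j <= d.+1)%N ->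
    c (d.+1 - j) d.+1 - s * c j d.+1 = c d.+1 d.+1 - s * c 0 d.+1.
Proof.
move=> sym; elim=> [|j IHj] lt_jd; first by rewrite subn0.
rewrite -IHj 1?ltnW // subSS.
have := pascal (leq_subr j d); have := pascal (j := j) (d := d) lt_jd.
rewrite (sym j lt_jd) -subSn // => -> ->; ring.
Qed.

Hypothesis edge1 : c 1 1 = - c 0 1.
Hypothesis edge_rec : forall n, (2 <= n)%N ->
  c n.+1 n.+1 + c 0 n.+1 + (c 0 n - c n n) / 2 = 0.

Lemma triangle_sym d j : (j <= d)%N -> c (d - j) d = (-1) ^+ d * c j d.
Proof.
elim: d j => [|d IHd] j; first by rewrite leqn0 => /eqP->; rewrite mul1r.
have sym i : (i <= d)%N -> c (d - i) d = - (-1) ^+ d.+1 * c i d.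
  by move=> /IHd ->; rewrite exprS mulN1r opprK.
have defect := triangle_defect_const sym.
(* The defect being constant, its vanishing at [j = 0] suffices. *)
suff edge : c d.+1 d.+1 = (-1) ^+ d.+1 * c 0 d.+1.
  by move=> /defect; rewrite edge subrr => /subr0_eq.
have := IHd d (leqnn d); rewrite subnn.
case: (boolP (odd d)) => odd_d.
  (* Here the sign is [+1], so the defects at the two ends are opposite as well as equal. *)
  have := defect _ (leqnn d.+1); rewrite subnn -signr_odd /= odd_d /=.
  by move=> dE _; lra.
rewrite -[in X in X -> _]signr_odd -[in X in _ -> X]signr_odd /= (negPf odd_d).
(* For even [d >= 2], symmetry of row [d] cancels the halved difference in [edge_rec]; [d = 0] is
   [edge1]. *)
rewrite !mul1r mulN1r; case: d {IHd sym defect} odd_d => [|[|d]] // _ dE.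
by have := edge_rec (n := d.+2) isT; lra.
Qed.

Hypotheses (c00_ge0 : 0 <= c 0 0) (c02_le0 : c 0 2 <= 0).

(** The two central entries of an odd row are opposite, and [pascal] gives their difference. *)
Lemma triangle_middle k : c k k.*2.+1 = c k k.*2 / 2.
Proof.
have lek : (k <= k.*2)%N by rewrite -addnn leq_addr.
have := pascal lek; have := triangle_sym (leqW lek).
rewrite -signr_odd /= odd_double.
have -> : (k.*2.+1 - k = k.+1)%N by lia.
by move=> -> ?; lra.
Qed.

Lemma triangle_edge k : c 0 k.+2.*2 = - (c 0 k.+1.*2.+1 / 2).
Proof.
have := triangle_sym (leq0n k.+2.*2); have := triangle_sym (leq0n k.+1.*2.+1).
have := edge_rec (n := k.+1.*2.+1) isT.
have even_sign i : (-1) ^+ i.*2 = 1 :> R by rewrite -signr_odd odd_double.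
rewrite !subn0 exprS !even_sign -!doubleS.
by move=> rec e1 e2; lra.
Qed.

Lemma triangle_sign k : forall j, (j <= k)%N ->
  0 <= (-1) ^+ k * c j k.*2 /\ 0 <= (-1) ^+ k * c j k.*2.+1.
Proof.
(* An odd row is filled from its middle leftwards, each step adding an entry of the even row before
   it. *)
have odd_row i : (forall j, (j <= i)%N -> 0 <= (-1) ^+ i * c j i.*2) ->
    forall p, (p <= i)%N -> 0 <= (-1) ^+ i * c (i - p) i.*2.+1.
  move=> even_row; elim=> [|p IHp] le_pi.
    by rewrite subn0 triangle_middle; have := even_row i (leqnn i); lra.
  rewrite pascal; last by lia.
  rewrite mulrDr addr_ge0 ?even_row ?leq_subr //.
  by have -> : ((i - p.+1).+1 = i - p)%N; [lia | apply: IHp; lia].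
suff even_row : forall j, (j <= k)%N -> 0 <= (-1) ^+ k * c j k.*2.
  move=> j le_jk; split; first exact: even_row.
  by rewrite -(subKn le_jk); apply: odd_row; rewrite ?leq_subr.
elim: k => [|k IHk]; first by move=> j; rewrite leqn0 => /eqP->; rewrite mul1r.
elim=> [_|j IHj lt_jk].
  (* The sign flips at the left edge. [triangle_edge] starts at row 4, so row 2 comes from
     [c02_le0]. *)
  case: k IHk => [_|k IHk]; first by rewrite expr1 mulN1r oppr_ge0.
  rewrite triangle_edge exprS.
  by have := odd_row _ IHk _ (leqnn _); rewrite subnn; lra.
(* Moving right in the even row subtracts an entry of the odd row before it, whose sign is
   opposite. *)
have rowk : 0 <= (-1) ^+ k * c j k.*2.+1.
  by have := odd_row _ IHk (k - j)%N (leq_subr _ _); rewrite subKn.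
have := IHj (ltnW lt_jk); rewrite doubleS (pascal (j := j)); last by lia.
by rewrite exprS; lra.
Qed.

End Triangle.

Section Signs.

Variable a : int.
Hypothesis a_le : a <= -1.

Lemma cG_sign k j : (j <= k)%N ->
  0 <= (-1) ^+ k * cG a j k.*2 /\ 0 <= (-1) ^+ k * cG a j k.*2.+1.
Proof.
have a_leQ : a%:~R <= -1 :> rat by rewrite (_ : -1 = (-1)%:~R) // ler_int.
have c00 : cG a 0 0 = 1 by rewrite cG_diag aG0 invr1.
have c11 : cG a 1 1 = - (1 / 2) by rewrite cG_diag aG1 expr1; lra.
have c22 : cG a 2 2 = a%:~R / 4 by rewrite cG_diag aG2; lra.
have c01 : cG a 0 1 = 1 / 2.
  by rewrite cG_pascal // c00 c11; lra.
(* The contributions of [aG a 0] and [aG a 1] cancel, so [a] alone fixes the sign. *)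
have c02 : cG a 0 2 = a%:~R / 4.
  by rewrite cG_pascal // [cG a 1 2]cG_pascal // c01 c11 c22; lra.
apply: (triangle_sign (c := cG a)).
- exact: cG_pascal.
- by rewrite c11 c01.
- exact: cG_rec.
- by rewrite c00.
- by rewrite c02; lra.
Qed.

Lemma cG_pos_even m j : (j <= 2 * m)%N ->
  0 <= cG a j (4 * m) /\ 0 <= cG a j (4 * m + 1).
Proof.
move=> /cG_sign; rewrite -signr_odd oddM !mul1r addn1.
by have -> : ((2 * m).*2 = 4 * m)%N by lia.
Qed.

Lemma cG_neg_odd m j : (j <= 2 * m + 1)%N ->
  cG a j (4 * m + 2) <= 0 /\ cG a j (4 * m + 3) <= 0.
Proof.
move=> /cG_sign; rewrite -signr_odd addn1 /= oddM expr1 !mulN1r !oppr_ge0.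
have -> : ((2 * m).+1.*2.+1 = 4 * m + 3)%N by lia.
by have -> : ((2 * m).+1.*2 = 4 * m + 2)%N by lia.
Qed.

End Signs.

Theorem mainTheorem14 (a : int) (ha : a <= -1) (m : nat) (hm : (1 <= m)%N) :
  [/\ 0 <= cG a 0 (4 * m) /\
      (forall j : nat, (j < 2 * m)%N ->
         cG a j (4 * m) <= cG a j.+1 (4 * m)),
      0 <= cG a (2 * m) (4 * m + 1) /\
      (forall j : nat, (j < 2 * m)%N ->
         cG a j.+1 (4 * m + 1) <= cG a j (4 * m + 1)),
      0 >= cG a 0 (4 * m + 2) /\
      (forall j : nat, (j < 2 * m + 1)%N ->
         cG a j (4 * m + 2) >= cG a j.+1 (4 * m + 2))
    & 0 >= cG a (2 * m + 1) (4 * m + 3) /\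
      (forall j : nat, (j < 2 * m + 1)%N ->
         cG a j.+1 (4 * m + 3) >= cG a j (4 * m + 3))].
Proof.
have pos := cG_pos_even ha (m := m); have neg := cG_neg_odd ha (m := m).
split; split.
- by case: (pos 0%N).
(* The preceding row [4 * m - 1] belongs to the previous block of four, hence the shift of [m],
   possible as [1 <= m]. *)
- case: m hm {pos neg} => // m _ j lt_j.
  have [|_] := cG_neg_odd ha (m := m) (j := j); first by lia.
  have -> : (4 * m.+1 = (4 * m + 3).+1)%N by lia.
  by rewrite (cG_pascal _ (j := j)); [lra | lia].
- by case: (pos (2 * m)%N).
- move=> j lt_j; have [c_ge0 _] := pos j (ltnW lt_j).
  by rewrite addn1 (cG_pascal _ (j := j)); [lra | lia].
- by case: (neg 0%N).
- move=> j lt_j; have [|_ c_ge0] := pos j; first by lia.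
  have -> : (4 * m + 2 = (4 * m + 1).+1)%N by lia.
  by rewrite (cG_pascal _ (j := j)); [lra | lia].
- by case: (neg (2 * m + 1)%N).
- move=> j lt_j; have [c_le0 _] := neg j (ltnW lt_j).
  by rewrite addnS (cG_pascal _ (j := j)); [lra | lia].
Qed.
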